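(* Let $l,r$ be positive integers, let $R=\{1,2,\dots,r\}\cup\{-1,-2,\dots,-l\}$, and let $m=\min\{l,r\}$. Then $$\mathsf{cap}(\mathbb Z_R)=\frac{m}{m+1}.$$
   Context: Fix a finite alphabet $Q$ of size $q\ge 2$. For a finite set $R\subset\mathbb Z\setminus\{0\}$, an $R$-recoverable system on $\mathbb Z$ is a nonempty set $X\subseteq Q^{\mathbb Z}$ such that for every $i\in\mathbb Z$ there is a function $f_i:Q^{|R|}\to Q$ (which may depend on $i$) with $x_i=f_i(x_{i+R})$ for all $x\in X$, where $x_{i+R}$ is the restriction of $x$ to $i+R=\{i+j:j\in R\}$. Its rate is $\mathcal R(X)=\limsup_{n\to\infty}\frac1n\log_q|B_n(X)|$, where $B_n(X)=\{x_{[n]}:x\in X\}$ and $[n]=\{0,1,\dots,n-1\}$. The capacity $\mathsf{cap}(\mathbb Z_R)$ is the supremum of $\mathcal R(X)$ over all $R$-recoverable systems $X\subseteq Q^{\mathbb Z}$. *)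

(* Defs.v *)
From HB Require Import structures.
From mathcomp Require Import all_boot all_order all_algebra.
From mathcomp Require Import finmap.
From mathcomp Require Import all_classical all_reals all_analysis.

Set Implicit Arguments.
Unset Strict Implicit.
Unset Printing Implicit Defensive.

Import Order.TTheory GRing.Theory Num.Theory.

Local Open Scope classical_set_scope.
Local Open Scope ring_scope.

Section Systems.
Context {Q : finType}.

(* x_{i+R}, reindexed by R through the translation j |-> i + j. *)
Definition shifted_restriction (R : {fset int}) (x : int -> Q) (i : int) :
    {ffun R -> Q} :=
  [ffun j : R => x (i + val j)].

(* Meant for R not containing 0. *)
Definition recoverable (R : {fset int}) (X : set (int -> Q)) : Prop :=
  X !=set0 /\
  forall i : int, exists f : {ffun R -> Q} -> Q,
    forall x, X x -> x i = f (shifted_restriction R x i).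

Definition window (n : nat) (x : int -> Q) : {ffun 'I_n -> Q} :=
  [ffun k : 'I_n => x (k : nat)%:Z].

Definition blocks (n : nat) (X : set (int -> Q)) : {set {ffun 'I_n -> Q}} :=
  [set w | `[< (window n @` X) w >]]%SET.

(* The term n = 0 has the junk value 0, which the limsup ignores. *)
Definition rate (K : realType) (X : set (int -> Q)) : \bar K :=
  limn_esup (fun n : nat =>
    ((n%:R)^-1 * (ln (#|blocks n X|%:R : K) / ln (#|Q|%:R : K)))%:E).

End Systems.

Definition capacity (K : realType) (Q : finType) (R : {fset int}) : \bar K :=
  ereal_sup [set rate K X | X in [set X : set (int -> Q) | recoverable R X]].

Definition interval_nbhd (l r : nat) : {fset int} :=
  ([fset k%:Z | k in iota 1 r] `|` [fset - k%:Z | k in iota 1 l])%fset.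

Lemma mem_interval_nbhd (l r : nat) (j : int) :
  (j \in interval_nbhd l r) = (1 <= j <= r%:Z) || (- l%:Z <= j <= -1).
Proof.
rewrite in_fsetU; congr (_ || _).
- apply/imfsetP/idP => [[k /= + ->]|]; rewrite ?mem_iota ?add1n ?ltnS //.
  by case: j => [n|n] //= h; exists n => //; rewrite mem_iota add1n ltnS.
- apply/imfsetP/idP => [[k /= + ->]|].
    by rewrite mem_iota add1n ltnS !lerN2 andbC.
  rewrite -[j]opprK !lerN2; move: (- j) => [n|n] //= h; exists n => //=.
  by rewrite mem_iota add1n ltnS andbC.
Qed.

Lemma interval_nbhd0 (l r : nat) : 0 \notin interval_nbhd l r.
Proof. by rewrite mem_interval_nbhd negb_or /= andbF. Qed.

(* Main.v *)
(** Lower bound: identify [Q] with a cyclic group and cut the line into blocks of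
    length [m + 1]; requiring every block to sum to zero lets each letter be
    recovered from the other [m] letters of its block, all within distance [m],
    while those [m] letters are free.
    Upper bound: among the multiples of [m + 1], each one has no other within
    distance [m]; as one side of the neighbourhood has length [m], a letter at
    such a position depends only on non-multiples and on multiples lying on the
    other side.  Hence, up to boundary effects, a block is determined by its
    letters at the non-multiples of [m + 1]. *)

Require Import Defs.
From mathcomp Require Import all_boot all_order all_algebra.
From mathcomp Require Import finmap.
From mathcomp Require Import all_classical all_reals all_analysis.
From mathcomp Require Import zify ring.

Import Order.TTheory GRing.Theory Num.Theory.

Local Open Scope ring_scope.

(** * Limits superior: linear bounds on log-counts become bounds on the rate *)

Section Rate.
Import numFieldNormedType.Exports.
Local Open Scope classical_set_scope.
Local Open Scope ring_scope.
Context {K : realType} {Q : finType}.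
Implicit Types (u v : nat -> \bar K) (c C : K) (X : set (int -> Q)).

Lemma le_limn_esup u v :
  (\forall n \near \oo, (u n <= v n)%E) -> (limn_esup u <= limn_esup v)%E.
Proof.
move=> uv; apply: le_ereal_inf_tmp => _ [V nV <-].
pose W := [set n | (u n <= v n)%E].
(* Shrinking [V] to the indices where the comparison holds can only lower the supremum of [u], and
   the shrunken set is still a neighbourhood of infinity. *)
apply: (le_trans (y := ereal_sup (u @` (V `&` W)))).
  by apply: ereal_inf_lbound; exists (V `&` W) => //; exact: filterI.
apply: ge_ereal_sup => _ [n [Vn uvn] <-]; apply: le_trans uvn _.
by apply: ereal_sup_ubound; exists n.
Qed.

(** Since [C / n] tends to 0, boundary effects of bounded size do not change the rate. *)
Lemma limn_esup_affine_div c C :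
  limn_esup (fun n => (n%:R^-1 * (c * n%:R + C))%:E) = c%:E :> \bar K.
Proof.
apply: (cvg_limn_einf_sup _).2; apply: cvg_EFin; first exact: nearW.
have inv0 : n%:R^-1 @[n --> \oo] --> (0 : K).
  rewrite -cvg_shiftS; exact: cvg_harmonic.
apply: (@cvg_trans _ ((c + C * n%:R^-1) @[n --> \oo])).
  apply: near_eq_cvg; near=> n.
  have n0 : n%:R != 0 :> K.
    by rewrite pnatr_eq0 -lt0n; near: n; exact: nbhs_infty_gt.
  by rewrite /=; field.
suff: c + C * n%:R^-1 @[n --> \oo] --> c + C * 0 by rewrite mulr0 addr0.
by apply: cvgD; [exact: cvg_cst|exact: cvgMl_tmp].
Unshelve. all: by end_near. Qed.

Lemma rate_le c C X :
  (forall n, ln #|blocks n X|%:R / ln #|Q|%:R <= c * n%:R + C) ->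
  (rate K X <= c%:E)%E.
Proof.
move=> leX; rewrite -(limn_esup_affine_div c C); apply: le_limn_esup.
by apply: nearW => n; rewrite lee_fin ler_wpM2l ?invr_ge0.
Qed.

Lemma rate_ge c C X :
  (forall n, c * n%:R + C <= ln #|blocks n X|%:R / ln #|Q|%:R) ->
  (c%:E <= rate K X)%E.
Proof.
move=> leX; rewrite -(limn_esup_affine_div c C); apply: le_limn_esup.
by apply: nearW => n; rewrite lee_fin ler_wpM2l ?invr_ge0.
Qed.

Lemma ln_card_le (hQ : (2 <= #|Q|)%N) (b e : nat) :
  (b <= #|Q| ^ e)%N -> ln b%:R / ln #|Q|%:R <= e%:R :> K.
Proof.
move=> be; have lnQ : 0 < ln #|Q|%:R :> K by rewrite ln_gt0// ltr1n.
have Qe : (0 < #|Q| ^ e)%N by rewrite expn_gt0; lia.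
rewrite ler_pdivrMr// mulr_natl; case: b be => [|b] be.
  (* For [b = 0] the logarithm takes its default value 0. *)
  by rewrite ln0// mulrn_wge0// ltW.
by rewrite -lnXn ?ltr0n -?natrX ?ler_ln ?posrE ?ler_nat ?ltr0n//; lia.
Qed.

Lemma ln_card_ge (hQ : (2 <= #|Q|)%N) (b e : nat) :
  (#|Q| ^ e <= b)%N -> e%:R <= ln b%:R / ln #|Q|%:R :> K.
Proof.
move=> be; have lnQ : 0 < ln #|Q|%:R :> K by rewrite ln_gt0// ltr1n.
have Qe : (0 < #|Q| ^ e)%N by rewrite expn_gt0; lia.
rewrite ler_pdivlMr// mulr_natl -lnXn ?ltr0n; last lia.
by rewrite -natrX ler_ln ?posrE ?ler_nat ?ltr0n//; lia.
Qed.

End Rate.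

(** * Counting blocks through determined and free coordinates *)

Section Blocks.
Context {Q : finType}.
Implicit Types (R : {fset int}) (X : set (int -> Q)) (x y : int -> Q).

(** A recovery function exists as soon as equal patterns force equal letters; both bounds use
    recoverability as this comparison of two configurations. *)
Lemma recoverableP R X : X !=set0%classic ->
  recoverable R X <->
  forall i x y, X x -> X y -> (forall j, j \in R -> x (i + j) = y (i + j)) ->
    x i = y i.
Proof.
move=> [x0 Xx0]; split=> [[_ recX] i x y Xx Xy xy|recX].
  have [f fP] := recX i; rewrite (fP _ Xx) (fP _ Xy); congr f.
  by apply/ffunP => j; rewrite !ffunE xy// (valP j).
split=> [|i]; first by exists x0.
(* Read the letter off any chosen element of [X] showing the pattern [w]; patterns that never occur
   get the filler [x0 i]. *)
exists (fun w => if pselect (exists2 x, X x & shifted_restriction R x i = w)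
                 is left ex then s2val (cid2 ex) i else x0 i) => x Xx.
case: pselect => [ex|[]]; last by exists x.
case: cid2 => y /= Xy /ffunP eqw; apply: recX => // j jR.
by have := eqw [` jR]%fset; rewrite !ffunE.
Qed.

Lemma mem_blocks n X w :
  reflect (exists2 x, X x & window n x = w) (w \in blocks n X).
Proof. by rewrite inE; apply: asboolP. Qed.

Definition restr {n} (A : {set 'I_n}) (w : {ffun 'I_n -> Q}) :
    {ffun {k : 'I_n | k \in A} -> Q} :=
  [ffun k => w (val k)].

Lemma card_restr n (A : {set 'I_n}) :
  #|{ffun {k : 'I_n | k \in A} -> Q}| = (#|Q| ^ #|A|)%N.
Proof. by rewrite card_ffun card_sig. Qed.

(* [mu] witnesses that the dependency digraph is acyclic on [S], so that [S]
   is determined by its complement. *)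
Lemma card_blocks_le R X n (S : {set 'I_n}) (mu : 'I_n -> nat) :
  recoverable R X ->
  (forall i, i \in S -> forall j, j \in R ->
    exists2 k : 'I_n, k%:Z = i%:Z + j & k \in S -> (mu k < mu i)%N) ->
  (#|blocks n X| <= #|Q| ^ (n - #|S|))%N.
Proof.
move=> recX acyc.
have -> : (n - #|S|)%N = #|~: S| by rewrite [RHS]cardsCs finset.setCK card_ord.
rewrite -card_restr; apply: (leq_card_in (restr (~: S))).
move=> _ _ /mem_blocks[x Xx <-] /mem_blocks[y Xy <-] /ffunP eqxy.
have eqC (k : 'I_n) : k \notin S -> x k = y k.
  by rewrite -finset.in_setC => kS; have := eqxy (exist _ k kS); rewrite !ffunE.
suff eqS m (k : 'I_n) : (mu k < m)%N -> x k = y k.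
  by apply/ffunP => k; rewrite !ffunE; exact: (eqS (mu k).+1).
elim: m k => // m IH k lek; have [kS|] := boolP (k \in S); last exact: eqC.
apply: (recoverableP R _ recX.1).1 recX _ _ _ Xx Xy _ => j jR.
have [k' <- muk'] := acyc _ kS _ jR.
have [k'S|] := boolP (k' \in S); last exact: eqC.
by apply: IH; have := muk' k'S; lia.
Qed.

(** Restriction to [A] maps the blocks onto all patterns on [A]. *)
Lemma card_blocks_ge X n (A : {set 'I_n}) :
  (forall w, exists2 x, X x & restr A (window n x) = w) ->
  (#|Q| ^ #|A| <= #|blocks n X|)%N.
Proof.
move=> ext; rewrite -card_restr -cardsT.
apply: leq_trans (leq_imset_card (restr A) (blocks n X)); apply: subset_leq_card.
apply/fintype.subsetP => w _; have [x Xx <-] := ext w.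
by apply/imsetP; exists (window n x) => //; apply/mem_blocks; exists x.
Qed.

End Blocks.

(** * Multiples of [c] in a window, and the upper bound *)

Lemma card_spaced_ge (c a b n : nat) : (0 < c)%N ->
  ((n - b - c * a) %/ c <=
    #|[set i : 'I_n | [&& (c %| i), (a <= i) & (i + b < n)]%N]|)%N.
Proof.
move=> c0; set k := (_ %/ c)%N.
(* The witnesses are [c * (a + j)]: starting at [c * a >= a] instead of the first multiple past [a]
   loses only a constant. *)
have inS (j : 'I_k) : (c * (a + j) + b < n)%N.
  by have := ltn_ord j; rewrite /k leq_divRL// mulSn; nia.
have ltn_S (j : 'I_k) : (c * (a + j) < n)%N by have := inS j; lia.
rewrite -[X in (X <= _)%N]card_ord -(card_imset (f := fun j => Ordinal (ltn_S j))).
  apply/subset_leq_card/fintype.subsetP => _ /imsetP[j _ ->].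
  by rewrite inE /= dvdn_mulr// inS andbT; nia.
by move=> j j' [] /eqP; rewrite eqn_pmul2l// eqn_add2l => /eqP/val_inj.
Qed.

Lemma card_multiples_le (c n : nat) : (0 < c)%N ->
  (#|[set i : 'I_n | (c %| i)%N]| <= (n %/ c).+1)%N.
Proof.
move=> c0; rewrite -[X in (_ <= X)%N]card_ord.
apply: (leq_card_in (fun i : 'I_n => inord (i %/ c) : 'I_(n %/ c).+1)) => i j.
have le_div (k : 'I_n) : (k %/ c < (n %/ c).+1)%N by rewrite ltnS leq_div2r// ltnW.
rewrite !inE => /dvdnP[u iE] /dvdnP[v jE] /(congr1 val) /=.
rewrite !inordK// => eq_div; apply: val_inj => /=.
by move: eq_div; rewrite iE jE !mulnK// => ->.
Qed.

(* On [S] the shorter side of the neighbourhood contains no element of [S], so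
   coordinates of [S] depend only on one another in one direction. *)
Lemma card_blocks_interval_le {Q : finType} (l r n : nat) (X : set (int -> Q)) :
  recoverable (interval_nbhd l r) X ->
  (#|blocks n X| <=
    #|Q| ^ (n - (n - r - (minn l r).+1 * l) %/ (minn l r).+1))%N.
Proof.
set m := minn l r => recX.
(* The margins [l] and [r] keep the whole neighbourhood of each element of [S] inside the window. *)
set S := [set i : 'I_n | [&& (m.+1 %| i), (l <= i) & (i + r < n)]%N].
have Q0 : (0 < #|Q|)%N.
  by case: recX => -[x _ _]; apply/card_gt0P; exists (x 0).
apply: (@leq_trans (#|Q| ^ (n - #|S|))%N); last first.
  by rewrite leq_pexp2l// leq_sub2l// card_spaced_ge.
apply: (@card_blocks_le _ _ _ _ _
  (* If [l <= r], then [m = l] and dependencies inside [S] point right, so [n - i] decreases;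
     otherwise [m = r] and they point left. *)
  (fun i : 'I_n => if (l <= r)%N then (n - i)%N else i)) recX _ => i.
rewrite inE => /and3P[/dvdnP[u iE] li irn] j; rewrite mem_interval_nbhd => jR.
have kn : (absz (i%:Z + j)%R < n)%N by lia.
exists (Ordinal kn) => /=; first lia.
rewrite inE /= => /and3P[/dvdnP[v kE] _ _].
have jE : (i%:Z + j = (v * m.+1)%N%:Z) by rewrite -kE; lia.
(* Equal multiples would give [j = 0]; distinct ones are at least [m + 1] apart, beyond the shorter
   side. *)
have [uv|vu|uv] := ltngtP u v; last by move: jE; rewrite iE uv; lia.
- have : (u.+1 * m.+1 <= v * m.+1)%N by rewrite leq_mul2r uv orbT.
  by case: ifPn; rewrite mulSn /m; lia.
- have : (v.+1 * m.+1 <= u * m.+1)%N by rewrite leq_mul2r vu orbT.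
  by case: ifPn; rewrite mulSn /m; lia.
Qed.

(** * The sum-zero system, for the lower bound *)

Section SumZero.
Context {Q : finType} {G : zmodType} {g : Q -> G} {h : G -> Q}.
Hypotheses (gK : cancel g h) (hK : cancel h g).

Definition sum_zero (m : nat) : set (int -> Q) :=
  [set x | forall a : int, \sum_(b < m.+1) g (x (a * m.+1%:Z + b%:Z)) = 0].

Lemma sum_zero_recoverable (l r : nat) :
  recoverable (interval_nbhd l r) (sum_zero (minn l r)).
Proof.
set m := minn l r.
have X0 : sum_zero m (fun=> h 0) by move=> a; apply: big1 => b _; rewrite hK.
apply/recoverableP; first by exists (fun=> h 0).
move=> i x y Xx Xy xy; apply: (can_inj gK).
have bm : (absz (i %% m.+1)%Z < m.+1)%N by lia.
pose b0 := Ordinal bm.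
have iE : i = (i %/ m.+1)%Z * m.+1%:Z + (b0 : nat)%:Z.
  by rewrite /= [LHS](divz_eq i m.+1); lia.
have block0 z : sum_zero m z ->
    g (z i) + \sum_(b < m.+1 | b != b0) g (z (i + (b%:Z - (b0 : nat)%:Z))) = 0.
  move=> Xz; rewrite -[RHS](Xz (i %/ m.+1)%Z) [RHS](bigD1 b0)//.
  congr (_ + _); first by rewrite {1}iE.
  by apply: eq_bigr => b _; congr (g (z _)); rewrite [X in X + _]iE; ring.
have := etrans (block0 x Xx) (esym (block0 y Xy)).
(* The offsets [b - b0] are nonzero and at most [m] in absolute value, so both sides of the
   neighbourhood cover them. *)
under eq_bigr => b b_neq.
  rewrite xy; last first.
    have : (b : nat) != b0 := b_neq.
    by have := ltn_ord b; rewrite mem_interval_nbhd /=; lia.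
  over.
exact: addIr.
Qed.

(** The first letter of each block acts as a check digit: it is set to minus the sum of the others,
    and disjoint blocks cannot conflict. *)
Lemma sum_zero_extend (m : nat) (y : int -> Q) :
  exists2 x, sum_zero m x & forall i, ~~ (m.+1 %| i)%Z -> x i = y i.
Proof.
exists (fun i => if (m.+1 %| i)%Z
  then h (- \sum_(b < m) g (y (i + (lift ord0 b : nat)%:Z))) else y i); last first.
  by move=> i /negbTE ->.
move=> a; rewrite big_ord_recl addr0 dvdz_mull// hK addrC; apply/eqP.
rewrite subr_eq0; apply/eqP/eq_bigr => b _; rewrite ifN//.
rewrite rpredDl ?dvdz_mull//; apply/negP => /(dvdn_leq (ltn0Sn _)).
by have := ltn_ord b; rewrite /= /bump /=; lia.
Qed.

Lemma card_blocks_sum_zero_ge (q0 : Q) (m n : nat) :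
  (#|Q| ^ (n - (n %/ m.+1).+1) <= #|blocks n (sum_zero m)|)%N.
Proof.
set S := [set i : 'I_n | (m.+1 %| i)%N].
apply: (@leq_trans (#|Q| ^ #|~: S|)%N).
  have -> : #|~: S| = (n - #|S|)%N by rewrite cardsCs finset.setCK card_ord.
  rewrite leq_pexp2l//; first by apply/card_gt0P; exists q0.
  by rewrite leq_sub2l// card_multiples_le.
apply: card_blocks_ge => w.
(* Extend [w] to the whole line, with filler [q0] wherever it prescribes nothing. *)
have [x Xx xE] := sum_zero_extend m (fun i =>
  oapp w q0 [pick k : {k : 'I_n | k \in ~: S} | (val k : nat)%:Z == i]).
exists x => //; apply/ffunP => k; rewrite !ffunE xE; last first.
  by have := valP k; rewrite !inE.
case: pickP => /= [k' /eqP[/val_inj/val_inj ->]//|/(_ k)].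
by rewrite eqxx.
Qed.

End SumZero.

Theorem proposition4p2 (K : realType) (Q : finType) (l r : nat)
    (hQ : (2 <= #|Q|)%N) (hl : (0 < l)%N) (hr : (0 < r)%N) :
  capacity K Q (interval_nbhd l r) =
    ((minn l r)%:R / ((minn l r) + 1)%:R)%:E.
Proof.
set m := minn l r; rewrite addn1.
have m0 : 0 < m.+1%:R :> K by rewrite ltr0n.
apply/eqP; rewrite eq_le; apply/andP; split.
  apply: ge_ereal_sup => _ [X recX <-].
  (* After multiplication by [m + 1], the margins and the division remainder cost at most
     [r + (m + 1) * l + m], which this constant covers. *)
  apply: (@rate_le _ _ _ (r + m.+1 * l.+1)%:R) => n.
  apply: le_trans (ln_card_le hQ _ _ (card_blocks_interval_le l r n X recX)) _.
  rewrite -/m -(ler_pM2r m0) mulrDl mulrAC divfK ?gt_eqF//.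
  rewrite -!natrM -natrD ler_nat.
  have := divn_eq (n - r - m.+1 * l) m.+1.
  by have := ltn_pmod (n - r - m.+1 * l) (ltn0Sn m); nia.
(* The successor form gives ['I_p.+1] its cyclic group structure. *)
have [p Qp] : {p | #|Q| = p.+1} by exists #|Q|.-1; lia.
pose g (a : Q) : 'I_p.+1 := cast_ord Qp (enum_rank a).
pose h (b : 'I_p.+1) : Q := enum_val (cast_ord (esym Qp) b).
have gK : cancel g h by move=> a; rewrite /g /h cast_ordK enum_rankK.
have hK : cancel h g by move=> b; rewrite /g /h enum_valK cast_ordKV.
apply: (@le_trans _ _ (rate K (@sum_zero Q _ g m))); last first.
  apply: ereal_sup_ubound; exists (@sum_zero Q _ g m) => //.
  exact: sum_zero_recoverable gK hK l r.
(* The loss of 1 is the extra multiple counted by [(n %/ m.+1).+1]. *)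
apply: (@rate_ge _ _ _ (- 1)) => n.
apply: le_trans (ln_card_ge hQ _ _ (card_blocks_sum_zero_ge hK (h 0) m n)).
rewrite -(ler_pM2r m0) mulrDl mulrAC divfK ?gt_eqF// mulN1r lerBlDr.
rewrite -!natrM -natrD ler_nat.
by have := divn_eq n m.+1; have := ltn_pmod n (ltn0Sn m); nia.
Qed.
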